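(* Let $\ell\ge 1$ and $n,m_1,\dots,m_\ell$ be positive integers, $m:=\sum_{i=1}^\ell m_i$. For $i=1,\dots,\ell$ let $C_i\subseteq\mathbb{R}^{m_i}$ be a nonempty polyhedral convex set and $A_i\in\mathbb{R}^{m_i\times n}$ a nonzero matrix, and let $\bar v\in\mathbb{R}^n$, with $\bigcap_{i=1}^\ell A_i^{-1}C_i\neq\emptyset$. Let $x^*$ be the unique solution of $\min_x\frac12\|x-\bar v\|^2$ subject to $A_ix\in C_i$, $i=1,\dots,\ell$. Let $d(\mathbf y):=\frac12\|\sum_{i=1}^\ell A_i^Ty_i-\bar v\|^2-\frac12\|\bar v\|^2+\sum_{i=1}^\ell\sigma_{C_i}(y_i)$ for $\mathbf y=(y_1,\dots,y_\ell)\in\mathbb{R}^m$, and $d^*:=\inf d$. Then $\operatorname{Argmin} d\neq\emptyset$. Moreover, let $\{x^t\},\{\mathbf y^t\}$ be generated by the following algorithm: set $\gamma_i:=\lambda_{\max}(A_i^TA_i)$, $y_i^0:=0$, $x^0:=x^0_\ell:=\bar v$; for $t=0,1,2,\dots$ set $x^{t+1}_0:=x^t_\ell$ and for $i=1,\dots,\ell$ compute $$x^{t+1}_i=(I-\gamma_i^{-1}A_i^TA_i)x^{t+1}_{i-1}+\gamma_i^{-1}A_i^T\operatorname{Proj}_{C_i}(\gamma_iy_i^t+A_ix^{t+1}_{i-1}),$$ $$y^{t+1}_i=y_i^t+\gamma_i^{-1}A_ix^{t+1}_{i-1}-\gamma_i^{-1}\operatorname{Proj}_{C_i}(\gamma_iy^t_i+A_ix^{t+1}_{i-1}),$$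 then set $x^{t+1}:=x^{t+1}_\ell$ and $\mathbf y^{t+1}:=(y^{t+1}_1,\dots,y^{t+1}_\ell)$. Then there exist $\mathbf y^*\in\operatorname{Argmin} d$, $r\in(0,1)$, $a_0\in(0,1)$, $a_1>0$ and a positive integer $\bar t$ such that for all $t\ge\bar t$, $$\|x^t-x^*\|\le a_1a_0^t,\quad d(\mathbf y^{t+1})-d^*\le r(d(\mathbf y^t)-d^* ),\quad\|\mathbf y^t-\mathbf y^*\|\le a_1a_0^t.$$
   Context: $A_i^{-1}S:=\{x:A_ix\in S\}$; $\sigma_C(y)=\sup_{u\in C}\langle y,u\rangle$ is the support function; $\operatorname{Proj}_C$ is the Euclidean projection onto $C$; $\lambda_{\max}$ is the largest eigenvalue. *)

(* Defs.v *)
From HB Require Import structures.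
From mathcomp Require Import all_boot all_order all_algebra.
From mathcomp Require Import boolp classical_sets reals constructive_ereal ereal.
Set Implicit Arguments. Unset Strict Implicit. Unset Printing Implicit Defensive.
Import Order.TTheory GRing.Theory Num.Theory.
Local Open Scope ring_scope.
Local Open Scope classical_set_scope.

Section Defs.
Variable R : realType.

Definition sqnorm (k : nat) (v : 'cV[R]_k) : R := \sum_(j < k) (v j 0) ^+ 2.
Definition enorm (k : nat) (v : 'cV[R]_k) : R := Num.sqrt (sqnorm v).

Definition inner (k : nat) (y u : 'cV[R]_k) : R := \sum_(j < k) y j 0 * u j 0.

Definition polyhedral (k : nat) (C : set 'cV[R]_k) : Prop :=
  exists (p : nat) (B : 'M[R]_(p, k)) (b : 'cV[R]_p),
    C = [set z | forall j : 'I_p, (B *m z) j 0 <= b j 0].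

Definition support_fun (k : nat) (C : set 'cV[R]_k) (y : 'cV[R]_k) : \bar R :=
  ereal_sup [set (inner y u)%:E | u in C].

Definition is_proj (k : nat) (C : set 'cV[R]_k) (z p : 'cV[R]_k) : Prop :=
  C p /\ forall c, C c -> enorm (z - p) <= enorm (z - c).

Definition is_lambda_max (k : nat) (M : 'M[R]_k) (g : R) : Prop :=
  eigenvalue M g /\ forall a, eigenvalue M a -> a <= g.

Definition prod_norm (l : nat) (m : 'I_l -> nat)
  (y : forall i : 'I_l, 'cV[R]_(m i)) : R :=
  Num.sqrt (\sum_(i < l) sqnorm (y i)).

Definition prod_dist (l : nat) (m : 'I_l -> nat)
  (y z : forall i : 'I_l, 'cV[R]_(m i)) : R :=
  Num.sqrt (\sum_(i < l) sqnorm (y i - z i)).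

Definition dual_fun (l n : nat) (m : 'I_l -> nat)
  (C : forall i : 'I_l, set 'cV[R]_(m i)) (A : forall i : 'I_l, 'M[R]_(m i, n))
  (vbar : 'cV[R]_n) (y : forall i : 'I_l, 'cV[R]_(m i)) : \bar R :=
  ((2^-1 * sqnorm ((\sum_(i < l) (A i)^T *m y i) - vbar)
    - 2^-1 * sqnorm vbar)%:E
   + \sum_(i < l) support_fun (C i) (y i))%E.

End Defs.

(* Main.v *)
(** Along the iterates y_i^{t+1} is normal to C_i at the projection p_i^t, so
    (x^{t+1}, y^{t+1}, p^t) solves the optimality system up to a residual
    A_i x - p_i controlled by the step D^t = y^{t+1} - y^t.  Since gamma_i bounds
    |A_i^T|^2, each sweep decreases d by a multiple of |D^t|^2; d being bounded
    below by weak duality, D^t -> 0.  Once multipliers of the inequalities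
    defining C_i are introduced, a small residual forces an exact solution at
    distance O(|D^t|) (a local Hoffman bound for each of the finitely many active
    sets, obtained by quantitative Fourier-Motzkin elimination).  This exact
    solution is a dual minimizer, and it gives
    d(y^{t+1}) - d* = O(|D^t|^2) = O(d(y^t) - d(y^{t+1})), i.e. linear decrease
    of the values, hence geometric decay of |D^t| and convergence of y^t. *)
Require Import Defs.
From HB Require Import structures.
From mathcomp Require Import all_boot all_order all_algebra.
From mathcomp Require Import boolp classical_sets reals constructive_ereal ereal.
From mathcomp Require Import ring lra.
Set Implicit Arguments.
Unset Strict Implicit.
Unset Printing Implicit Defensive.
Import Order.TTheory GRing.Theory Num.Theory.
Local Open Scope ring_scope.
Local Open Scope classical_set_scope.

(** * Linear inequalities: quantitative Fourier-Motzkin elimination, a local Hoffman bound, Farkas'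
    lemma *)

Lemma ge_sum_term (R : realFieldType) (I : finType) (F : I -> R) (i : I) :
  (forall j, 0 <= F j) -> F i <= \sum_j F j.
Proof. by move=> F0; rewrite (bigD1 i) //= lerDl sumr_ge0. Qed.
Arguments ge_sum_term {R I} F i.

(** The witness is the largest of the lower bounds [g] and of [lo], the smallest of 0 and the upper
    bounds [f]. Including 0 keeps [lo] between [- h] and 0, also when [P] or [Q] is empty. *)
Lemma exists_between (R : realFieldType) (I : finType) (P Q : pred I)
    (f g : I -> R) (h : R) :
  0 <= h ->
  (forall i, P i -> - h <= f i) -> (forall j, Q j -> g j <= h) ->
  (forall i j, P i -> Q j -> g j <= f i) ->
  exists s, [/\ `|s| <= h, forall i, P i -> s <= f i & forall j, Q j -> g j <= s].
Proof.
move=> h0 fh gh gf.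
pose lo := \big[Num.min/0]_(i | P i) f i.
have lof i : P i -> lo <= f i by move=> Pi; exact: bigmin_le_cond.
have lo0 : lo <= 0 by exact: bigmin_le_id.
have loh : - h <= lo by apply/bigmin_geP; split => //; rewrite oppr_le0.
exists (\big[Num.max/lo]_(j | Q j) g j); split.
- rewrite ler_norml (le_trans loh (bigmax_ge_id _ _ _ _)) /=.
  by apply/bigmax_leP; split => //; exact: le_trans h0.
- by move=> i Pi; apply/bigmax_leP; split => [|j Qj]; [exact: lof|exact: gf].
- by move=> j Qj; exact: le_bigmax_cond.
Qed.

(** The signed violation of the constraint with row [a] and bound [b]: the constraint holds when the
    value is at most 0. *)
Definition affine (R : realFieldType) (T : finType) (a : T -> R) (b : R)
  (u : T -> R) : R := \sum_k a k * u k - b.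

Lemma affine_perturb (R : realFieldType) (T : finType) (a : T -> R) (b : R)
    (u w : T -> R) (e : R) :
  (forall k, `|w k - u k| <= e) ->
  affine a b w <= affine a b u + (\sum_k `|a k|) * e.
Proof.
move=> wu; rewrite /affine addrAC lerD2r -lerBlDl -sumrB mulr_suml.
apply: ler_sum => k _; rewrite -mulrBr (le_trans (ler_norm _)) // normrM.
exact: ler_wpM2l.
Qed.

Lemma affine_update (R : realFieldType) (T : finType) (a : T -> R) (b : R)
    (u : T -> R) (t : T) (s : R) :
  affine a b (fun k => if k == t then u k + s else u k) = affine a b u + a t * s.
Proof.
rewrite /affine (bigD1 t) //= [in RHS](bigD1 t) //= eqxx.
rewrite (eq_bigr (fun k => a k * u k)) => [|k /negPf ->] //.
ring.
Qed.

Section FourierMotzkin.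
Variables (R : realFieldType) (T : finType).

(* The pair (i, j) stands for the combination of rows i and j that cancels the
   coefficient of t; rows of [inl] or [inr] type that do not apply are zero. *)
Definition fm_row (J : finType) (a : J -> R) (x y : J -> R) (j : J + J * J) : R :=
  match j with
  | inl j => if a j == 0 then x j else 0
  | inr (i, j) =>
      if (0 < a i) && (a j < 0) then a i * y j - a j * y i else 0
  end.

(** Rows with positive coefficient at [t] bound the shift of [u t] from above, rows with negative
    coefficient from below. The combined rows say that these bounds are compatible, and residuals of
    at most [e] allow a shift of size at most [K * e]. *)
Lemma fourier_motzkin_step (J : finType) (a : J -> T -> R) (b : J -> R) (t : T) :
  exists (J' : finType) (a' : J' -> T -> R) (b' : J' -> R) (K : R),
  [/\ 0 <= K,
    forall k, k = t \/ (forall j, a j k = 0) -> forall j, a' j k = 0,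
    forall u e, 0 <= e -> (forall j, affine (a j) (b j) u <= e) ->
      forall j, affine (a' j) (b' j) u <= K * e &
    forall u e, 0 <= e -> (forall j, affine (a' j) (b' j) u <= 0) ->
      (forall j, affine (a j) (b j) u <= e) ->
      exists w, [/\ forall k, k != t -> w k = u k,
        forall k, `|w k - u k| <= K * e & forall j, affine (a j) (b j) w <= 0]].
Proof.
pose at_ j := a j t.
pose a' j k := fm_row at_ (fun j => a j k) (fun j => a j k) j.
pose b' j := fm_row at_ b b j.
have E1 u j : at_ j = 0 -> affine (a' (inl j)) (b' (inl j)) u = affine (a j) (b j) u.
  by move=> h; rewrite /affine /a' /b' /= h eqxx.
have E2 u i j : 0 < at_ i -> at_ j < 0 ->
    affine (a' (inr (i, j))) (b' (inr (i, j))) u =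
    at_ i * affine (a j) (b j) u - at_ j * affine (a i) (b i) u.
  move=> hi hj; rewrite /affine /a' /b' /= hi hj /= !mulrBr !mulr_sumr.
  under eq_bigr do rewrite mulrBl -!mulrA.
  by rewrite sumrB; ring.
(* The 1 serves rows without [t], the two equal sums the factor [at_ i - at_ j] of a combination,
   and the last sum the size of the shift. *)
pose K := 1 + \sum_j `|at_ j| + \sum_j `|at_ j| + \sum_j `|at_ j|^-1.
have S0 : 0 <= \sum_j `|at_ j| by exact: sumr_ge0.
have V0 : 0 <= \sum_j `|at_ j|^-1 by apply: sumr_ge0 => j _; rewrite invr_ge0.
have Sj j : `|at_ j| <= \sum_j `|at_ j| by apply: ge_sum_term.
have Vj j : `|at_ j|^-1 <= \sum_j `|at_ j|^-1.
  by apply: (ge_sum_term (fun j => `|at_ j|^-1)) => i; rewrite invr_ge0.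
have K0 : 0 <= K by rewrite /K; lra.
exists (J + J * J)%type, a', b', K; split => //.
- move=> k [->|ak] [j|[i j]]; rewrite /a' /=.
  + by case: eqP.
  + by case: ifP => // _; rewrite /at_ mulrC subrr.
  + by case: ifP.
  + by case: ifP => // _; rewrite !ak !mulr0 subrr.
- move=> u e e0 H [j|[i j]].
  + have [h|h] := eqVneq (at_ j) 0.
      by rewrite E1 // (le_trans (H j)) // ler_peMl // /K; lra.
    rewrite /affine /a' /b' /= (negPf h) big1 => [|k _]; last by rewrite mul0r.
    by rewrite subr0 mulr_ge0.
  + case hij : ((0 < at_ i) && (at_ j < 0)); last first.
      rewrite /affine /a' /b' /= hij big1 => [|k _]; last by rewrite mul0r.
      by rewrite subr0 mulr_ge0.
    case/andP: hij => hi hj; rewrite E2 //.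
    have := Sj i; have := Sj j; rewrite (gtr0_norm hi) (ltr0_norm hj) => sj si.
    have h1 : at_ i * affine (a j) (b j) u <= at_ i * e by rewrite ler_pM2l.
    have h2 : - at_ j * affine (a i) (b i) u <= - at_ j * e.
      by rewrite ler_pM2l ?oppr_gt0.
    have h3 : (at_ i - at_ j) * e <= K * e by apply: ler_wpM2r => //; rewrite /K; lra.
    move: h1 h2 h3; rewrite mulNr mulNr mulrBl; lra.
- move=> u e e0 H' H.
  (* The shift of [u t] that makes row [j] tight. *)
  pose f j := - affine (a j) (b j) u / at_ j.
  have f_bound j : at_ j != 0 -> `|at_ j|^-1 * e <= K * e.
    by move=> _; apply: ler_wpM2r => //; have := Vj j; rewrite /K; lra.
  have [|||s [sK sP sN]] := @exists_between R J
      (fun j => 0 < at_ j) (fun j => at_ j < 0) f f (K * e) (mulr_ge0 K0 e0).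
  + move=> i hi; rewrite /f mulNr lerN2 ler_pdivrMr //.
    have := f_bound i (lt0r_neq0 hi); rewrite gtr0_norm // => h.
    by rewrite (le_trans (H i)) // -ler_pdivrMr // mulrC.
  + move=> i hi; rewrite /f mulNr -mulrN -invrN ler_pdivrMr ?oppr_gt0 //.
    have := f_bound i (ltr0_neq0 hi); rewrite ltr0_norm // => h.
    by rewrite (le_trans (H i)) // -ler_pdivrMr ?oppr_gt0 // mulrC.
  + move=> i j hi hj; have := H' (inr (i, j)); rewrite E2 // => h.
    rewrite /f ler_pdivlMr // mulrAC ler_ndivrMr //; lra.
  exists (fun k => if k == t then u k + s else u k); split.
  + by move=> k /negPf ->.
  + move=> k; case: ifP => _; first by rewrite addrAC subrr add0r.
    by rewrite subrr normr0 mulr_ge0.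
  + move=> j; rewrite affine_update -/(at_ j).
    have [h|h|h] := ltgtP (at_ j) 0.
    * by have := sN j h; rewrite /f ler_ndivrMr // => h'; lra.
    * by have := sP j h; rewrite /f ler_pdivlMr // => h'; lra.
    * by rewrite h mul0r addr0 -E1 //; exact: H'.
Qed.

(** Lifting goes backwards: the variables in the tail are repaired first, [t] last. The first repair
    disturbs the original rows by at most [S * (K2 * K1) * e], so the repair of [t] starts from the
    residual [L * e]. *)
Lemma fourier_motzkin (s : seq T) (J : finType) (a : J -> T -> R) (b : J -> R) :
  exists (J' : finType) (a' : J' -> T -> R) (b' : J' -> R) (K : R),
  [/\ 0 <= K,
    forall k, k \in s \/ (forall j, a j k = 0) -> forall j, a' j k = 0,
    forall u e, 0 <= e -> (forall j, affine (a j) (b j) u <= e) ->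
      forall j, affine (a' j) (b' j) u <= K * e &
    forall u e, 0 <= e -> (forall j, affine (a' j) (b' j) u <= 0) ->
      (forall j, affine (a j) (b j) u <= e) ->
      exists w, [/\ forall k, k \notin s -> w k = u k,
        forall k, `|w k - u k| <= K * e & forall j, affine (a j) (b j) w <= 0]].
Proof.
elim: s J a b => [|t s IH] J a b.
  exists J, a, b, 1; split => //.
  - by move=> k [].
  - by move=> u e _ H j; rewrite mul1r.
  - move=> u e e0 H _; exists u; split => // k.
    by rewrite subrr normr0 mul1r.
have [J1 [a1 [b1 [K1 [K10 Z1 D1 U1]]]]] := fourier_motzkin_step a b t.
have [J2 [a2 [b2 [K2 [K20 Z2 D2 U2]]]]] := IH J1 a1 b1.
pose S := \sum_j \sum_k `|a j k|.
have S0 : 0 <= S by do 2! apply: sumr_ge0 => ? _.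
have Sj j : \sum_k `|a j k| <= S.
  by apply: (ge_sum_term (fun j => \sum_k `|a j k|)) => i; apply: sumr_ge0.
pose L := 1 + S * (K2 * K1).
have L0 : 0 <= L by rewrite /L addr_ge0 // !mulr_ge0.
exists J2, a2, b2, (K2 * K1 + K1 * L); split.
- by rewrite addr_ge0 ?mulr_ge0.
- move=> k hk; apply: Z2; rewrite inE in hk.
  case: hk => [/orP[/eqP ->|ks]|ak]; [right|by left|right].
  + by apply: Z1; left.
  + by apply: Z1; right.
- move=> u e e0 H j; have K1e : 0 <= K1 * e by rewrite mulr_ge0.
  apply: (le_trans (D2 u _ K1e (D1 u e e0 H) j)).
  by rewrite mulrDl mulrA lerDl !mulr_ge0.
- move=> u e e0 H2 H; have K1e : 0 <= K1 * e by rewrite mulr_ge0.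
  have [w1 [w1s w1u w1H]] := U2 u _ K1e H2 (D1 u e e0 H).
  have Lw1 j : affine (a j) (b j) w1 <= L * e.
    apply: (le_trans (affine_perturb (a j) (b j) w1u)).
    have : (\sum_k `|a j k|) * (K2 * (K1 * e)) <= S * (K2 * (K1 * e)).
      by rewrite ler_wpM2r // mulr_ge0.
    have := H j; rewrite /L mulrDl mul1r -!mulrA; lra.
  have [w [wt ww1 wH]] := U1 w1 (L * e) (mulr_ge0 L0 e0) w1H Lw1.
  exists w; split => //.
  + by move=> k; rewrite inE negb_or => /andP[kt ks]; rewrite wt // w1s.
  + move=> k; have -> : w k - u k = (w1 k - u k) + (w k - w1 k) by ring.
    rewrite (le_trans (ler_normD _ _)) // mulrDl -!mulrA lerD //.
Qed.

(** Once all variables are eliminated the rows are constants. If one of them is violated, [e0] is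
    taken so small that no point has residual at most [e0]; otherwise the eliminated system holds
    trivially and lifting gives the exact solution. *)
Lemma hoffman_local (J : finType) (a : J -> T -> R) (b : J -> R) :
  exists K e0 : R, [/\ 0 <= K, 0 < e0 &
    forall u e, 0 <= e <= e0 -> (forall j, affine (a j) (b j) u <= e) ->
      exists w, (forall k, `|w k - u k| <= K * e) /\
                forall j, affine (a j) (b j) w <= 0].
Proof.
have [J' [a' [b' [K [K0 Z D U]]]]] := fourier_motzkin (enum T) a b.
have E j u : affine (a' j) (b' j) u = - b' j.
  rewrite /affine big1 ?sub0r // => k _.
  by rewrite Z ?mul0r //; left; rewrite mem_enum.
have [[j bj]|nb] := pselect (exists j, b' j < 0).
  exists K, (- b' j / (1 + K) / 2); split => //.
    by rewrite !divr_gt0 ?oppr_gt0 // ltr_wpDr.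
  move=> u e /andP[e0 ee] /(D u e e0)/(_ j); rewrite E => h.
  exfalso; have K1 : 0 < 1 + K by rewrite ltr_wpDr.
  have : (1 + K) * e <= (1 + K) * (- b' j / (1 + K) / 2) by rewrite ler_pM2l.
  have -> : (1 + K) * (- b' j / (1 + K) / 2) = - b' j / 2.
    by field; rewrite gt_eqF.
  lra.
exists K, 1; split => // u e /andP[e0 _] H.
have [|//|w [_ wu wH]] := U u e e0; last by exists w.
move=> j; rewrite E oppr_le0 leNgt; apply/negP => bj; apply: nb; by exists j.
Qed.

End FourierMotzkin.

(** The cone generated by the [g j] is the projection onto z of the polyhedron z = sum_j c_j g_j, c
    >= 0. Eliminating c describes the cone by inequalities in z; their normals lie in the polar
    cone, so the hypothesis makes [y] satisfy them, and lifting [y] recovers the coefficients. *)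
Lemma farkas (R : realFieldType) (p k : nat) (g : 'I_p -> 'I_k -> R) (y : 'I_k -> R) :
  (forall d : 'I_k -> R, (forall j, \sum_i g j i * d i <= 0) ->
     \sum_i y i * d i <= 0) ->
  exists c : 'I_p -> R, (forall j, 0 <= c j) /\
    forall i, y i = \sum_j c j * g j i.
Proof.
move=> Hy.
pose T := ('I_k + 'I_p)%type; pose J := ('I_k + 'I_k + 'I_p)%type.
pose a (j : J) (t : T) : R := match j, t with
  | inl (inl i), inl i' => (i == i')%:R
  | inl (inl i), inr j => - g j i
  | inl (inr i), inl i' => - (i == i')%:R
  | inl (inr i), inr j => g j i
  | inr j, inl _ => 0
  | inr j, inr j' => - (j == j')%:R
  end.
pose mk (z : 'I_k -> R) (c : 'I_p -> R) (t : T) : R :=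
  match t with inl i => z i | inr j => c j end.
have delta_sum (q : nat) (i : 'I_q) (F : 'I_q -> R) :
    \sum_j (i == j)%:R * F j = F i.
  rewrite (bigD1 i) //= eqxx mul1r big1 ?addr0 // => j.
  by rewrite eq_sym => /negPf ->; rewrite mul0r.
have deltaN_sum (q : nat) (i : 'I_q) (F : 'I_q -> R) :
    \sum_j - (i == j)%:R * F j = - F i.
  by under eq_bigr do rewrite mulNr; rewrite sumrN delta_sum.
have ev1 u i : affine (a (inl (inl i))) 0 u =
    u (inl i) - \sum_j u (inr j) * g j i.
  rewrite /affine subr0 big_sumType /= delta_sum -sumrN; congr (_ + _).
  by apply: eq_bigr => j _; rewrite mulNr mulrC.
have ev2 u i : affine (a (inl (inr i))) 0 u =
    - u (inl i) + \sum_j u (inr j) * g j i.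
  rewrite /affine subr0 big_sumType /= deltaN_sum; congr (_ + _).
  by apply: eq_bigr => j _; rewrite mulrC.
have ev3 u j : affine (a (inr j)) 0 u = - u (inr j).
  rewrite /affine subr0 big_sumType /= deltaN_sum.
  by rewrite big1 ?add0r // => i _; rewrite mul0r.
have [J' [a' [b' [K [K0 Z D U]]]]] :=
  @fourier_motzkin R T [seq inr j | j <- enum 'I_p] J a (fun=> 0).
have Z' j j' : a' j (inr j') = 0.
  by apply: Z; left; apply: map_f; rewrite mem_enum.
have ev' j u : affine (a' j) (b' j) u = \sum_i a' j (inl i) * u (inl i) - b' j.
  rewrite /affine big_sumType /= [X in _ + X - _]big1 ?addr0 // => i _.
  by rewrite Z' mul0r.
(* Points of the cone satisfy the eliminated rows: the residual transfer with [e = 0]. *)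
have cone (c : 'I_p -> R) j : (forall i, 0 <= c i) ->
    \sum_i a' j (inl i) * (\sum_h c h * g h i) <= b' j.
  move=> c0; rewrite -subr_le0.
  pose u := mk (fun i => \sum_h c h * g h i) c.
  have := D u 0 (lexx 0); rewrite mulr0 => /(_ _ j); rewrite ev'; apply.
  by case=> [[i|i]|i]; rewrite ?ev1 ?ev2 ?ev3 /= ?subrr ?addNr ?oppr_le0.
have b0 j : 0 <= b' j.
  have := cone (fun=> 0) j (fun=> lexx 0); rewrite big1 // => i _.
  by rewrite big1 ?mulr0 // => h _; rewrite mul0r.
(* Otherwise the multiple [(b' j + 1) / S] of the generator [g h] would violate [cone]. *)
have polar j h : \sum_i g h i * a' j (inl i) <= 0.
  rewrite leNgt; apply/negP => pos; set S := \sum_i _ in pos.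
  have c0 i : 0 <= ((b' j + 1) / S) * (h == i)%:R.
    by rewrite mulr_ge0 ?ler0n // divr_ge0 ?addr_ge0 // ltW.
  have := cone _ j c0.
  under eq_bigr => i _.
    rewrite (_ : \sum_h0 _ = (b' j + 1) / S * g h i); last first.
      by rewrite -[in RHS](delta_sum _ h (g ^~ i)) mulr_sumr; apply: eq_bigr => ? _; ring.
    rewrite (_ : _ * _ = (b' j + 1) / S * (g h i * a' j (inl i))); last by ring.
    over.
  rewrite -mulr_sumr -/S divfK ?gt_eqF //; lra.
pose u := mk y (fun=> 0).
(* Lifting asks for some residual bound; only the exactness of the lifted point is used, so a crude
   one suffices. *)
pose e := \sum_j `|affine (a j) 0 u|.
have [||| w [w1 _ w2]] := U u e.
- exact: sumr_ge0.
- move=> j; rewrite ev' subr_le0 (le_trans _ (b0 j)) //=.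
  have := Hy (fun i => a' j (inl i)) (polar j).
  by under eq_bigr do rewrite mulrC.
- move=> j; rewrite (le_trans (ler_norm _)) //.
  exact: (ge_sum_term (fun j => `|affine (a j) 0 u|)).
exists (fun j => w (inr j)); split.
  by move=> j; have := w2 (inr j); rewrite ev3 oppr_le0.
move=> i; have := w2 (inl (inl i)); have := w2 (inl (inr i)).
rewrite ev1 ev2 w1 /=; last first.
  by apply/negP => /mapP[].
move=> h1 h2; apply/eqP; rewrite eq_le; apply/andP; split; lra.
Qed.

(** * Inner products and coordinatewise estimates *)

Section InnerProduct.
Variable R : realType.
Implicit Types k n : nat.

Lemma innerC k (u v : 'cV[R]_k) : inner u v = inner v u.
Proof. by apply: eq_bigr => j _; rewrite mulrC. Qed.

Lemma innerDl k (u v w : 'cV[R]_k) : inner (u + v) w = inner u w + inner v w.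
Proof. by rewrite -big_split; apply: eq_bigr => j _; rewrite mxE mulrDl. Qed.

Lemma innerZl k (a : R) (u w : 'cV[R]_k) : inner (a *: u) w = a * inner u w.
Proof. by rewrite mulr_sumr; apply: eq_bigr => j _; rewrite mxE mulrA. Qed.

Lemma innerNl k (u w : 'cV[R]_k) : inner (- u) w = - inner u w.
Proof. by rewrite -scaleN1r innerZl mulN1r. Qed.

Lemma innerBl k (u v w : 'cV[R]_k) : inner (u - v) w = inner u w - inner v w.
Proof. by rewrite innerDl innerNl. Qed.

Lemma inner0l k (w : 'cV[R]_k) : inner 0 w = 0.
Proof. by rewrite -(scale0r 0) innerZl mul0r. Qed.

Lemma inner_suml k (I : finType) (F : I -> 'cV[R]_k) w :
  inner (\sum_i F i) w = \sum_i inner (F i) w.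
Proof. exact: (big_morph (@inner R k ^~ w) (fun u v => innerDl u v w) (inner0l w)). Qed.

Lemma innerDr k (u v w : 'cV[R]_k) : inner w (u + v) = inner w u + inner w v.
Proof. by rewrite !(innerC w) innerDl. Qed.

Lemma innerBr k (u v w : 'cV[R]_k) : inner w (u - v) = inner w u - inner w v.
Proof. by rewrite !(innerC w) innerBl. Qed.

Lemma innerZr k (a : R) (u w : 'cV[R]_k) : inner w (a *: u) = a * inner w u.
Proof. by rewrite !(innerC w) innerZl. Qed.

Lemma innerNr k (u w : 'cV[R]_k) : inner w (- u) = - inner w u.
Proof. by rewrite !(innerC w) innerNl. Qed.

Lemma inner0r k (w : 'cV[R]_k) : inner w 0 = 0.
Proof. by rewrite innerC inner0l. Qed.

Lemma inner_trmx k n (M : 'M[R]_(k, n)) (u : 'cV[R]_k) (v : 'cV[R]_n) :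
  inner (M^T *m u) v = inner u (M *m v).
Proof.
rewrite /inner.
under eq_bigr => j _ do rewrite mxE mulr_suml.
rewrite exchange_big /=; apply: eq_bigr => i _.
by rewrite mxE mulr_sumr; apply: eq_bigr => j _; rewrite mxE; ring.
Qed.

Lemma sqnormE k (u : 'cV[R]_k) : sqnorm u = inner u u.
Proof. by apply: eq_bigr => j _; rewrite expr2. Qed.

Lemma sqnorm_ge0 k (u : 'cV[R]_k) : 0 <= sqnorm u.
Proof. by apply: sumr_ge0 => j _; exact: sqr_ge0. Qed.

Lemma sqnorm_eq0 k (u : 'cV[R]_k) : sqnorm u = 0 -> u = 0.
Proof.
move=> /eqP; rewrite psumr_eq0 => [/allP H|j _]; last exact: sqr_ge0.
apply/matrixP => j j0; rewrite ord1 mxE; apply/eqP.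
by rewrite -sqrf_eq0; apply: H; rewrite mem_index_enum.
Qed.

Lemma sqnormD k (u v : 'cV[R]_k) :
  sqnorm (u + v) = sqnorm u + 2 * inner u v + sqnorm v.
Proof. by rewrite !sqnormE innerDl !innerDr (innerC v u); ring. Qed.

Lemma sqnormN k (u : 'cV[R]_k) : sqnorm (- u) = sqnorm u.
Proof. by rewrite !sqnormE innerNl innerNr opprK. Qed.

Lemma sqnormB k (u v : 'cV[R]_k) :
  sqnorm (u - v) = sqnorm u - 2 * inner u v + sqnorm v.
Proof. by rewrite sqnormD sqnormN innerNr; ring. Qed.

Lemma sqnormZ k (a : R) (u : 'cV[R]_k) : sqnorm (a *: u) = a ^+ 2 * sqnorm u.
Proof. by rewrite !sqnormE innerZl innerZr; ring. Qed.

Lemma sqnorm_ge_entry k (u : 'cV[R]_k) j : (u j 0) ^+ 2 <= sqnorm u.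
Proof. by apply: (ge_sum_term (fun j => (u j 0) ^+ 2)) => i; exact: sqr_ge0. Qed.

Definition entry_bound k (u : 'cV[R]_k) (e : R) := forall j, `|u j 0| <= e.

(** A crude bound for the operator norm with respect to the maximum norm. *)
Definition mx_sum_norm k n (M : 'M[R]_(k, n)) : R := \sum_i \sum_j `|M i j|.

Lemma mx_sum_norm_ge0 k n (M : 'M[R]_(k, n)) : 0 <= mx_sum_norm M.
Proof. by do 2! apply: sumr_ge0 => ? _. Qed.

Lemma mulmx_entry_bound k n (M : 'M[R]_(k, n)) (u : 'cV[R]_n) e :
  0 <= e -> entry_bound u e -> entry_bound (M *m u) (mx_sum_norm M * e).
Proof.
move=> e0 ue i; rewrite mxE (le_trans (ler_norm_sum _ _ _)) //.
apply: (@le_trans _ _ ((\sum_j `|M i j|) * e)).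
  by rewrite mulr_suml; apply: ler_sum => j _; rewrite normrM ler_wpM2l.
rewrite ler_wpM2r // (ge_sum_term (fun i => \sum_j `|M i j|)) // => h.
exact: sumr_ge0.
Qed.

Lemma sum_entry_bound k (I : finType) (F : I -> 'cV[R]_k) (e : I -> R) :
  (forall i, entry_bound (F i) (e i)) -> entry_bound (\sum_i F i) (\sum_i e i).
Proof.
move=> H j; rewrite summxE (le_trans (ler_norm_sum _ _ _)) //.
by apply: ler_sum => i _; exact: H.
Qed.

Lemma entry_boundD k (u v : 'cV[R]_k) e f :
  entry_bound u e -> entry_bound v f -> entry_bound (u + v) (e + f).
Proof.
by move=> ue vf j; rewrite mxE (le_trans (ler_normD _ _)) // lerD ?ue ?vf.
Qed.

Lemma entry_boundN k (u : 'cV[R]_k) e : entry_bound u e -> entry_bound (- u) e.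
Proof. by move=> ue j; rewrite mxE normrN. Qed.

Lemma entry_boundZ k (u : 'cV[R]_k) a e :
  entry_bound u e -> entry_bound (a *: u) (`|a| * e).
Proof. by move=> ue j; rewrite mxE normrM ler_wpM2l. Qed.

Lemma inner_entry_bound k (u v : 'cV[R]_k) e f :
  0 <= e -> entry_bound u e -> entry_bound v f -> `|inner u v| <= k%:R * (e * f).
Proof.
move=> e0 ue vf; rewrite (le_trans (ler_norm_sum _ _ _)) //.
rewrite (@le_trans _ _ (\sum_(j < k) e * f)) //; last first.
  by rewrite sumr_const card_ord mulr_natl.
by apply: ler_sum => j _; rewrite normrM ler_pM // ?ue ?vf.
Qed.

Lemma entry_bound_sqnorm k (u : 'cV[R]_k) e :
  0 <= e -> entry_bound u e -> sqnorm u <= k%:R * e ^+ 2.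
Proof.
move=> e0 ue; rewrite sqnormE (le_trans (ler_norm _)) //.
by rewrite (le_trans (inner_entry_bound e0 ue ue)) // expr2.
Qed.

End InnerProduct.

(** * Error bound for a linear complementarity system *)

(** Complementarity becomes linear once a set [S] is fixed outside which multipliers vanish and
    inside which constraints are tight. [hoffman_local] applies to each of the finitely many [S];
    the sum of the constants and the minimum of the thresholds serve all of them. *)
Lemma kkt_error_bound (R : realType) (T : finType) (n : nat)
    (N : T -> 'cV[R]_n) (v : 'cV[R]_n) (b : T -> R) :
  let x (c : T -> R) := v - \sum_k c k *: N k in
  exists K e0 : R, [/\ 0 <= K, 0 < e0 &
    forall c e, 0 <= e <= e0 -> (forall k, 0 <= c k) ->
      (forall k, inner (N k) (x c) <= b k + e) ->
      (forall k, c k != 0 -> b k - e <= inner (N k) (x c)) ->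
      exists w, [/\ forall k, `|w k - c k| <= K * e, forall k, 0 <= w k,
        forall k, inner (N k) (x w) <= b k &
        forall k, w k != 0 -> inner (N k) (x w) = b k]].
Proof.
move=> x.
pose q k := inner (N k) v.
have xE c k : inner (N k) (x c) = q k - \sum_h c h * inner (N k) (N h).
  rewrite /x innerBr -/(q k) (innerC _ (\sum_h _)) inner_suml; congr (_ - _).
  by apply: eq_bigr => h _; rewrite innerZl innerC.
pose J := ((T + T) + (T + T))%type.
pose a (S : {set T}) (j : J) (h : T) : R := match j with
  | inl (inl k) => - (k == h)%:R
  | inl (inr k) => if k \in S then 0 else (k == h)%:R
  | inr (inl k) => - inner (N k) (N h)
  | inr (inr k) => if k \in S then inner (N k) (N h) else 0
  end.
pose d (S : {set T}) (j : J) : R := match j with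
  | inl _ => 0
  | inr (inl k) => b k - q k
  | inr (inr k) => if k \in S then q k - b k else 0
  end.
have delta_sum k (F : T -> R) : \sum_h (k == h)%:R * F h = F k.
  rewrite (bigD1 k) //= eqxx mul1r big1 ?addr0 // => j.
  by rewrite eq_sym => /negPf ->; rewrite mul0r.
have e1 S k u : affine (a S (inl (inl k))) (d S (inl (inl k))) u = - u k.
  rewrite /affine /= subr0; under eq_bigr do rewrite mulNr.
  by rewrite sumrN delta_sum.
have e2 S k u : affine (a S (inl (inr k))) (d S (inl (inr k))) u =
    if k \in S then 0 else u k.
  rewrite /affine /= subr0; case: ifP => _; last exact: delta_sum.
  by rewrite big1 // => h _; rewrite mul0r.
have e3 S k u : affine (a S (inr (inl k))) (d S (inr (inl k))) u =
    inner (N k) (x u) - b k.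
  rewrite /affine xE /=; under eq_bigr do rewrite mulNr mulrC.
  by rewrite sumrN; ring.
have e4 S k u : affine (a S (inr (inr k))) (d S (inr (inr k))) u =
    if k \in S then b k - inner (N k) (x u) else 0.
  rewrite /affine xE /=; case: ifP => _; last first.
    by rewrite big1 ?subr0 // => h _; rewrite mul0r.
  by under eq_bigr do rewrite mulrC; ring.
have [f Hf] := choice (fun S => hoffman_local (a S) (d S)).
have [g Hg] := choice Hf.
exists (\sum_S f S), (\big[Num.min/1]_S g S); split.
- by apply: sumr_ge0 => S _; case: (Hg S).
- by apply/bigmin_gtP; split => // S _; case: (Hg S).
move=> c e /andP[e_ge0 ee] c0 Hx Hc.
(* With the support of [c] as [S], the point [c] solves the linear system up to [e]; an exact
   solution [w] vanishes off [S], hence is complementary. *)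
pose S := [set k | c k != 0]%SET.
have [_ _ /(_ c e)] := Hg S.
rewrite e_ge0 (le_trans ee) ?bigmin_le //= => /(_ isT) [|w [wc wH]].
  move=> [[k|k]|[k|k]]; rewrite ?e1 ?e2 ?e3 ?e4.
  - by rewrite (le_trans _ e_ge0) // oppr_le0.
  - by rewrite inE; case: eqVneq => [->|_].
  - by rewrite lerBlDl.
  - by rewrite inE; case: eqVneq => //= k0; have := Hc k k0; lra.
exists w; split.
- move=> k; rewrite (le_trans (wc k)) // ler_wpM2r //.
  by apply: (ge_sum_term f) => U; case: (Hg U).
- by move=> k; have := wH (inl (inl k)); rewrite e1 oppr_le0.
- by move=> k; have := wH (inr (inl k)); rewrite e3 subr_le0.
- move=> k wk; have := wH (inr (inl k)); rewrite e3.
  have := wH (inr (inr k)); rewrite e4; case: ifP => kS h1 h2.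
    by apply/eqP; rewrite eq_le; apply/andP; split; lra.
  have := wH (inl (inr k)); have := wH (inl (inl k)); rewrite e1 e2 kS => h3 h4.
  by exfalso; move/eqP: wk; apply; lra.
Qed.

(** * Rayleigh quotients and the largest eigenvalue *)

Section Rayleigh.
Variable R : realType.

Lemma entry_bound_sqrt k (u : 'cV[R]_k) : entry_bound u (enorm u).
Proof.
by move=> j; rewrite -sqrtr_sqr ler_wsqrtr // sqnorm_ge_entry.
Qed.

Lemma enorm_ge0 k (u : 'cV[R]_k) : 0 <= enorm u.
Proof. exact: sqrtr_ge0. Qed.

Lemma enorm_sqr k (u : 'cV[R]_k) : enorm u ^+ 2 = sqnorm u.
Proof. by rewrite sqr_sqrtr ?sqnorm_ge0. Qed.

Lemma mulmx_sqnorm_le k n (M : 'M[R]_(k, n)) (u : 'cV[R]_n) :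
  sqnorm (M *m u) <= k%:R * mx_sum_norm M ^+ 2 * sqnorm u.
Proof.
have := mulmx_entry_bound M (enorm_ge0 u) (entry_bound_sqrt u).
move=> /(entry_bound_sqnorm (mulr_ge0 (mx_sum_norm_ge0 M) (enorm_ge0 u))).
by rewrite exprMn enorm_sqr mulrA.
Qed.

Lemma quadratic_form_le n (M : 'M[R]_n) (u : 'cV[R]_n) :
  inner (M *m u) u <= n%:R * mx_sum_norm M * sqnorm u.
Proof.
have H := mulmx_entry_bound M (enorm_ge0 u) (entry_bound_sqrt u).
have := inner_entry_bound (mulr_ge0 (mx_sum_norm_ge0 M) (enorm_ge0 u)) H
  (entry_bound_sqrt u).
by move/(le_trans (ler_norm _)); rewrite -(mulrA (mx_sum_norm M)) -expr2 enorm_sqr mulrA.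
Qed.

(** Evaluate the nonnegative quadratic form of [S] at x - K^-1 S x. *)
Lemma psd_sqnorm_le n (S : 'M[R]_n) (K : R) (x : 'cV[R]_n) :
  S^T = S -> 0 < K -> (forall u, 0 <= inner (S *m u) u <= K * sqnorm u) ->
  sqnorm (S *m x) <= K * inner (S *m x) x.
Proof.
move=> sS K0 HS; set y := S *m x.
have := HS (x - K^-1 *: y) => /andP[+ _].
have /andP[_ hy] := HS y.
have yx : inner (S *m y) x = sqnorm y by rewrite -{1}sS inner_trmx sqnormE.
rewrite mulmxBr -scalemxAr -/y innerBr !innerBl innerZr innerZl innerZr yx.
rewrite innerZl -sqnormE => h.
have h2 : K^-1 * (K^-1 * inner (S *m y) y) <= K^-1 * sqnorm y.
  by rewrite ler_pM2l ?invr_gt0 // mulrC ler_pdivrMr // mulrC.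
have : K^-1 * sqnorm y <= inner y x by lra.
by rewrite mulrC ler_pdivrMr // mulrC.
Qed.

(* The supremum mu of the Rayleigh quotient is an eigenvalue: otherwise mu - M
   is positive semidefinite and invertible, hence bounded below by a positive
   multiple of the identity, and mu could be decreased. *)
Lemma rayleigh_le n (M : 'M[R]_n) (g : R) (x : 'cV[R]_n) :
  M^T = M -> is_lambda_max M g -> inner (M *m x) x <= g * sqnorm x.
Proof.
move=> sM [_ gmax]; rewrite leNgt; apply/negP => gx.
have x0 : 0 < sqnorm x.
  rewrite lt_neqAle sqnorm_ge0 andbT eq_sym; apply/eqP => /[dup] /sqnorm_eq0 x0 x1.
  by move: gx; rewrite x1 x0 inner0r mulr0 ltxx.
pose U : set R := [set c | forall u, inner (M *m u) u <= c * sqnorm u].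
have U0 : U !=set0 by exists (n%:R * mx_sum_norm M) => u; exact: quadratic_form_le.
have Ulb u : 0 < sqnorm u -> lbound U (inner (M *m u) u / sqnorm u).
  by move=> u0 c Uc; rewrite ler_pdivrMr.
have Ub : has_lbound U by exists (inner (M *m x) x / sqnorm x); exact: Ulb.
pose mu := inf U.
have Umu u : inner (M *m u) u <= mu * sqnorm u.
  have [u0|u0] := eqVneq (sqnorm u) 0.
    by rewrite u0 mulr0 (sqnorm_eq0 u0) inner0r.
  have {}u0 : 0 < sqnorm u by rewrite lt_neqAle eq_sym u0 sqnorm_ge0.
  by rewrite -ler_pdivrMr //; apply: lb_le_inf => //; exact: Ulb.
have gmu : g < mu.
  apply: (@lt_le_trans _ _ (inner (M *m x) x / sqnorm x)).
    by rewrite ltr_pdivlMr.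
  by apply: lb_le_inf => //; exact: Ulb.
have unitS : M - mu%:M \in unitmx.
  rewrite -row_free_unit -kermx_eq0; apply: contraTT gmu => ev.
  by rewrite -leNgt; exact: gmax.
pose S := mu%:M - M.
have SN : S = - (M - mu%:M) by rewrite opprB.
have SE u : inner (S *m u) u = mu * sqnorm u - inner (M *m u) u.
  by rewrite mulmxBl mul_scalar_mx innerBl innerZl sqnormE.
have sS : S^T = S by rewrite /S linearB /= tr_scalar_mx sM.
pose K := 1 + n%:R * mx_sum_norm S.
have K0 : 0 < K by rewrite /K ltr_pwDl // mulr_ge0 ?ler0n ?mx_sum_norm_ge0.
have HS u : 0 <= inner (S *m u) u <= K * sqnorm u.
  apply/andP; split; first by rewrite SE subr_ge0.
  by rewrite (le_trans (quadratic_form_le S u)) // ler_wpM2r ?sqnorm_ge0 // /K; lra.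
pose V := invmx (M - mu%:M).
pose L := 1 + n%:R * mx_sum_norm V ^+ 2.
have L0 : 0 < L by rewrite /L ltr_pwDl // mulr_ge0 ?ler0n // sqr_ge0.
have low u : sqnorm u <= L * K * inner (S *m u) u.
  have -> : sqnorm u = sqnorm (V *m (S *m u)).
    by rewrite SN mulNmx mulmxN sqnormN mulKmx.
  rewrite (le_trans (mulmx_sqnorm_le _ _)) //.
  apply: (@le_trans _ _ (L * sqnorm (S *m u))).
    by rewrite ler_wpM2r ?sqnorm_ge0 // /L; lra.
  by rewrite -mulrA ler_pM2l //; exact: psd_sqnorm_le.
have : mu <= mu - (L * K)^-1.
  apply: ge_inf => // u; have := low u; rewrite SE mulrC -ler_pdivrMr ?mulr_gt0 //.
  by move=> h; rewrite mulrBl (mulrC (L * K)^-1); lra.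
by rewrite lerDl oppr_ge0 invr_le0 leNgt mulr_gt0.
Qed.

(** The Rayleigh bound gives |A x|^2 <= g |x|^2. It passes to the transpose by expanding |g u - A
    A^T u|^2 >= 0; a nonzero column of [A] makes [g] positive. *)
Lemma trmx_sqnorm_le k n (A : 'M[R]_(k, n)) (g : R) :
  A != 0 -> is_lambda_max (A^T *m A) g ->
  0 < g /\ forall u, sqnorm (A^T *m u) <= g * sqnorm u.
Proof.
move=> A0 gmax.
have Ag x : sqnorm (A *m x) <= g * sqnorm x.
  have := @rayleigh_le n _ g x _ gmax; rewrite trmx_mul trmxK => /(_ erefl).
  by rewrite -mulmxA inner_trmx sqnormE.
have [x Ax] : exists x : 'cV[R]_n, A *m x != 0.
  apply/not_existsP => H; move/eqP: A0; apply.
  apply/matrixP => i j; have := H (delta_mx j 0); rewrite -colE => /negP.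
  by rewrite negbK => /eqP/matrixP/(_ i 0); rewrite !mxE.
have Ax0 : 0 < sqnorm (A *m x).
  rewrite lt_neqAle sqnorm_ge0 andbT eq_sym.
  by apply: contra_neq Ax; exact: sqnorm_eq0.
have g0 : 0 < g.
  rewrite ltNge; apply/negP => g0; have := lt_le_trans Ax0 (Ag x).
  by rewrite ltNge mulr_le0_ge0 ?sqnorm_ge0.
split=> // u; set w := A^T *m u.
have := sqnorm_ge0 (g *: u - A *m w).
rewrite sqnormB sqnormZ innerZl -inner_trmx -/w -sqnormE => h.
have : g * sqnorm w <= g * (g * sqnorm u) by have := Ag w; lra.
by rewrite ler_pM2l.
Qed.

End Rayleigh.

(** * Normal cones, projections and multipliers for polyhedra *)

Section NormalCone.
Variable R : realType.

(** The graph of the normal cone: [p] lies in [C] and attains the support function at [y]. *)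
Definition normal_at k (C : set 'cV[R]_k) (p y : 'cV[R]_k) : Prop :=
  C p /\ forall c, C c -> inner y c <= inner y p.

Lemma support_fun_normal k (C : set 'cV[R]_k) p y :
  normal_at C p y -> support_fun C y = (inner y p)%:E.
Proof.
move=> [Cp Hp]; apply/eqP; rewrite eq_le; apply/andP; split.
  by apply: ub_ereal_sup => _ [c Cc <-]; rewrite lee_fin; exact: Hp.
by apply: ereal_sup_ubound; exists p.
Qed.

Lemma proj_normal k (C : set 'cV[R]_k) z p :
  polyhedral C -> is_proj C z p -> normal_at C p (z - p).
Proof.
move=> [q [B [b ->]]] [Cp Hp]; split => // c Cc.
rewrite -subr_le0 -innerBr leNgt; apply/negP.
set w := c - p; set al := inner _ _ => al0; pose be := sqnorm w.
have be0 : 0 <= be by exact: sqnorm_ge0.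
have ab0 : 0 < al + be by lra.
(* Moving from [p] towards [c] by this fraction stays in [C] by convexity; since [s * be < 2 * al],
   it would come strictly closer to [z] than [p]. *)
pose s := al / (al + be).
have s0 : 0 < s by rewrite divr_gt0.
have s1 : s <= 1 by rewrite ler_pdivrMr //; lra.
have /Hp : forall j, (B *m (p + s *: w)) j 0 <= b j 0.
  move=> j; have -> : p + s *: w = (1 - s) *: p + s *: c.
    by rewrite /w scalerBr scalerBl scale1r; rewrite addrCA addrC -!addrA (addrC (- _)).
  rewrite mulmxDr -!scalemxAr !mxE.
  have h1 : (1 - s) * (B *m p) j 0 <= (1 - s) * b j 0.
    by apply: ler_wpM2l; [lra|exact: Cp].
  have h2 : s * (B *m c) j 0 <= s * b j 0 by apply: ler_wpM2l; [lra|exact: Cc].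
  by move: h1 h2; rewrite !mxE; lra.
rewrite ler_sqrt ?sqnorm_ge0 // opprD addrA (sqnormB (z - p)) innerZr sqnormZ -/al -/be => h.
have : 2 * al * s <= s * be * s by rewrite expr2 in h; lra.
rewrite ler_pM2r // leNgt => /negP; apply.
rewrite /s mulrAC ltr_pdivrMr //.
have : 0 < al * al by rewrite mulr_gt0.
have : 0 <= al * be by rewrite mulr_ge0 // ltW.
lra.
Qed.

(** A direction that does not increase any active row can be followed for a short time inside the
    polyhedron, so [y] does not increase along it. Farkas, with the inactive rows replaced by zero,
    then yields the multipliers. *)
Lemma normal_polyhedral k q (B : 'M[R]_(q, k)) (b : 'cV[R]_q) p y :
  normal_at [set z | forall j, (B *m z) j 0 <= b j 0] p y ->
  exists c : 'I_q -> R, [/\ forall j, 0 <= c j, y = B^T *m (\col_j c j) &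
    forall j, c j != 0 -> (B *m p) j 0 = b j 0].
Proof.
move=> [Cp Hp].
pose act j := (B *m p) j 0 == b j 0.
have [d dy|c [c0 cy]] := @farkas R q k (fun j i => if act j then B j i else 0) (y ^~ 0).
  pose w : 'cV[R]_k := \col_i d i.
  have Bw j : act j -> (B *m w) j 0 <= 0.
    move=> aj; have := dy j; rewrite aj mxE.
    by under [X in _ -> X <= 0]eq_bigr do rewrite mxE.
  (* Ratio test over the inactive rows: their positive slack bounds the step, and adding 1 keeps the
     denominators positive. *)
  pose s := \big[Num.min/1]_(j | ~~ act j) ((b j 0 - (B *m p) j 0) / (1 + `|(B *m w) j 0|)).
  have pos j : 0 < 1 + `|(B *m w) j 0| by rewrite ltr_pwDl.
  have s0 : 0 < s.
    apply/bigmin_gtP; split => // j aj; rewrite divr_gt0 // subr_gt0.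
    by rewrite lt_neqAle aj; exact: Cp.
  have Cs : forall j, (B *m (p + s *: w)) j 0 <= b j 0.
    move=> j; rewrite mulmxDr -scalemxAr mxE [X in _ + X]mxE.
    have [aj|aj] := boolP (act j).
      by rewrite (eqP aj) gerDl mulr_ge0_le0 ?Bw // ltW.
    have : s <= (b j 0 - (B *m p) j 0) / (1 + `|(B *m w) j 0|).
      exact: (bigmin_le_cond 1 (fun j => (b j 0 - (B *m p) j 0) / (1 + `|(B *m w) j 0|))).
    rewrite ler_pdivlMr // mulrDr mulr1 => h.
    have : s * (B *m w) j 0 <= s * `|(B *m w) j 0| by rewrite ler_pM2l // ler_norm.
    lra.
  have := Hp _ Cs; rewrite innerDr innerZr gerDl pmulr_rle0 //.
  by rewrite /inner; under eq_bigr do rewrite mxE.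
exists (fun j => if act j then c j else 0); split.
- by move=> j; case: ifP.
- apply/matrixP => i i0; rewrite ord1 {i0} cy mxE; apply: eq_bigr => j _.
  by rewrite !mxE; case: ifP; rewrite ?mulr0 // mulrC.
- by move=> j; case: ifP => [/eqP //|_]; rewrite eqxx.
Qed.

End NormalCone.

(** * Real sequences with geometric bounds *)

Section Sequences.
Variable R : realType.
Implicit Types (u F : nat -> R) (a c r : R).

(** If [a] were positive, so would be the supremum of the lower bounds of the tail; shifting the
    index by one shows that this supremum divided by [r] is again a lower bound, a contradiction. *)
Lemma le0_of_le_geometric a c r t0 :
  0 < r < 1 -> (forall t, (t0 <= t)%N -> a <= c * r ^+ t) -> a <= 0.
Proof.
move=> /andP[r0 r1] H; rewrite leNgt; apply/negP => a0.
pose S : set R := [set s | forall t, (t0 <= t)%N -> s <= c * r ^+ t].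
have Sb : has_ubound S by exists (c * r ^+ t0) => s; apply.
have Sn : S !=set0 by exists a.
have aS : a <= sup S by exact: ub_le_sup.
have : sup S / r <= sup S.
  apply: ub_le_sup => // t t0t; rewrite ler_pdivrMr // -mulrA -exprSr.
  by apply: ge_sup => // s; apply; exact: leqW.
have S0 := lt_le_trans a0 aS.
rewrite ler_pdivrMr // leNgt => /negP; apply.
by rewrite gtr_pMr.
Qed.

(** With [g] the tail of the geometric series, u - g increases and u + g decreases from [t0] on; the
    limit is the supremum of u - g. *)
Lemma geometric_cauchy u t0 c r :
  0 < r < 1 -> 0 <= c ->
  (forall t, (t0 <= t)%N -> `|u t.+1 - u t| <= c * r ^+ t) ->
  exists L, forall t, (t0 <= t)%N -> `|u t - L| <= c / (1 - r) * r ^+ t.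
Proof.
move=> /andP[r0 r1] c0 H.
pose g t := c / (1 - r) * r ^+ t.
have gS t : g t - g t.+1 = c * r ^+ t.
  by rewrite /g exprS; field; rewrite gt_eqF // subr_gt0.
have g0 t : 0 <= g t.
  by rewrite mulr_ge0 ?exprn_ge0 ?divr_ge0 ?subr_ge0 // ltW.
have lo t k : (t0 <= t)%N -> u t - g t <= u (t + k)%N - g (t + k)%N.
  move=> t0t; elim: k => [|k IH]; first by rewrite addn0.
  rewrite (le_trans IH) // addnS; have := H _ (leq_trans t0t (leq_addr k t)).
  by rewrite ler_norml -gS => /andP[h _]; lra.
have hi t k : (t0 <= t)%N -> u (t + k)%N + g (t + k)%N <= u t + g t.
  move=> t0t; elim: k => [|k IH]; first by rewrite addn0.
  rewrite (le_trans _ IH) // addnS; have := H _ (leq_trans t0t (leq_addr k t)).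
  by rewrite ler_norml -gS => /andP[_ h]; lra.
have lohi s t : (t0 <= s)%N -> (t0 <= t)%N -> u s - g s <= u t + g t.
  move=> hs ht; rewrite (le_trans (lo s t hs)) //.
  by rewrite (le_trans _ (hi t s ht)) // addnC; have := g0 (t + s)%N; lra.
pose S : set R := [set u s - g s | s in [set s | (t0 <= s)%N]].
exists (sup S) => t t0t; rewrite -/(g t).
have h1 : u t - g t <= sup S.
  apply: ub_le_sup; last by exists t.
  by exists (u t0 + g t0) => _ [s hs <-]; exact: lohi.
have h2 : sup S <= u t + g t.
  by apply: ge_sup => [|_ [s hs <-]]; [exists (u t - g t), t|exact: lohi].
by rewrite ler_norml; apply/andP; split; lra.
Qed.

(** Past an index where [F] is within [e] of its infimum, no decrement can exceed [e]. *)
Lemma decrement_small F b e :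
  (forall t, b <= F t) -> (forall t, F t.+1 <= F t) -> 0 < e ->
  exists t0, forall t, (t0 <= t)%N -> F t - F t.+1 <= e.
Proof.
move=> Fb Fd e0.
pose S := range F.
have Sb : has_lbound S by exists b => _ [t _ <-].
have Si : has_inf S by split => //; exists (F 0%N), 0%N.
have [_ [t0 _ <-] h] := inf_adherent e0 Si.
exists t0 => t t0t.
have mono k : F (t0 + k)%N <= F t0.
  by elim: k => [|k IH]; rewrite ?addn0 // addnS (le_trans (Fd _)).
have := mono (t - t0)%N; rewrite subnKC // => h1.
have : inf S <= F t.+1 by apply: ge_inf => //; exists t.+1.
lra.
Qed.

End Sequences.

(** * Duality, the optimality system and its error bound *)

Section Duality.
Variables (R : realType) (l n : nat) (m : 'I_l -> nat).
Variables (C : forall i : 'I_l, set 'cV[R]_(m i)).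
Arguments C : clear implicits.
Variables (A : forall i : 'I_l, 'M[R]_(m i, n)) (vbar : 'cV[R]_n).
Local Notation dualT := (forall i : 'I_l, 'cV[R]_(m i)).
Implicit Types (y p : dualT) (x : 'cV[R]_n).

(** The minimiser in x of the Lagrangian at [y]. *)
Definition primal y : 'cV[R]_n := vbar - \sum_i (A i)^T *m y i.

(** The real value of the dual function when the supremum for block i is attained at [p i]. *)
Definition dual_val y p : R :=
  2^-1 * sqnorm (primal y) - 2^-1 * sqnorm vbar + \sum_i inner (y i) (p i).

(** Minus the primal objective, since [dual_fun] is the negated dual, to be minimised. *)
Definition opt_val x : R := - (2^-1 * sqnorm (x - vbar)).

Definition kkt x y : Prop :=
  (forall i, normal_at (C i) (A i *m x) (y i)) /\ primal y = x.

Lemma sum_inner_primal y x : \sum_i inner (y i) (A i *m x) = inner (vbar - primal y) x.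
Proof.
rewrite /primal opprB addrC subrK inner_suml.
by apply: eq_bigr => i _; rewrite inner_trmx.
Qed.

Lemma primal_sub y z : primal y - primal z = - \sum_i (A i)^T *m (y i - z i).
Proof.
rewrite /primal opprB (addrC (_ - _)) addrA subrK -sumrB -sumrN.
by apply: eq_bigr => i _; rewrite mulmxBr opprB.
Qed.

Lemma dual_fun_normal y p :
  (forall i, normal_at (C i) (p i) (y i)) ->
  dual_fun C A vbar y = (dual_val y p)%:E.
Proof.
move=> H; rewrite /dual_fun /dual_val -sqnormN opprB [RHS]EFinD -sumEFin.
by congr (_ + _)%E; apply: eq_bigr => i _; exact: support_fun_normal.
Qed.

(** Weak duality: replacing each support function by its value at A_i x leaves a gap of |primal y -
    x|^2 / 2. *)
Lemma dual_fun_ge y x :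
  (forall i, C i (A i *m x)) -> ((opt_val x)%:E <= dual_fun C A vbar y)%E.
Proof.
move=> xC.
apply: (@le_trans _ _ ((2^-1 * sqnorm (primal y) - 2^-1 * sqnorm vbar)%:E
   + \sum_(i < l) (inner (y i) (A i *m x))%:E)%E).
  rewrite sumEFin -EFinD lee_fin sum_inner_primal /opt_val.
  move: (primal y) => w; have := sqnorm_ge0 (w - x).
  rewrite !sqnormB innerBl (innerC vbar); lra.
rewrite /dual_fun -sqnormN opprB; apply: leeD => //; apply: lee_sum => i _.
by apply: ereal_sup_ubound; exists (A i *m x).
Qed.

Lemma kkt_dual_fun x y : kkt x y -> dual_fun C A vbar y = (opt_val x)%:E.
Proof.
move=> [H Hx]; rewrite (dual_fun_normal H) /dual_val sum_inner_primal Hx.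
congr (_%:E); rewrite /opt_val sqnormB innerBl -sqnormE (innerC x); lra.
Qed.

Lemma kkt_argmin x y z : kkt x y -> (dual_fun C A vbar y <= dual_fun C A vbar z)%E.
Proof.
move=> H; rewrite (kkt_dual_fun H); apply: dual_fun_ge => i.
by case: H => /(_ i)[].
Qed.

(** Normality gives <vbar - x, z - x> <= 0; expanding |z - vbar|^2 around [x], minimality of [z]
    then forces |z - x|^2 <= 0. *)
Lemma kkt_unique x y z :
  kkt x y -> (forall i, C i (A i *m z)) ->
  (forall w, (forall i, C i (A i *m w)) ->
     2^-1 * sqnorm (z - vbar) <= 2^-1 * sqnorm (w - vbar)) ->
  x = z.
Proof.
move=> [Hn Hx] zC zmin.
have xC i : C i (A i *m x) by case: (Hn i).
have : inner (vbar - x) (z - x) <= 0.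
  rewrite innerBr subr_le0 -Hx -!sum_inner_primal Hx.
  by apply: ler_sum => i _; apply: (Hn i).2.
have := zmin x xC.
have -> : z - vbar = (z - x) - (vbar - x) by rewrite opprB addrA subrK.
rewrite sqnormB (innerC (z - x)) -(sqnormN (x - vbar)) opprB => h1 h2.
apply/eqP; rewrite eq_sym -subr_eq0; apply/eqP/sqnorm_eq0/eqP.
by rewrite eq_le sqnorm_ge0 andbT; lra.
Qed.

(** The subgradient inequality at [y], where the vectors p_i - A_i (primal y) form a subgradient.
    The bound is a product of distance and residual, hence quadratic when both are of first
    order. *)
Lemma dual_gap_le x y p z :
  (forall i, normal_at (C i) (p i) (y i)) -> kkt x z ->
  dual_val y p - opt_val x <=
  \sum_i inner (z i - y i) (A i *m primal y - p i).
Proof.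
move=> Hy Hz; have [Hn Hx] := Hz.
have -> : opt_val x = dual_val z (fun i => A i *m x).
  by apply: EFin_inj; rewrite -(kkt_dual_fun Hz) -dual_fun_normal.
have h : \sum_i inner (z i) (p i) <= \sum_i inner (z i) (A i *m x).
  by apply: ler_sum => i _; apply: (Hn i).2; case: (Hy i).
have -> : \sum_i inner (z i - y i) (A i *m primal y - p i) =
    inner (primal y - x) (primal y) - \sum_i inner (z i) (p i) + \sum_i inner (y i) (p i).
  under eq_bigr do rewrite innerBr !innerBl opprB.
  rewrite big_split /= !sumrB !sum_inner_primal Hx.
  by move: (primal y) => w; rewrite !innerBl; lra.
rewrite /dual_val !sum_inner_primal Hx.
move: (primal y) h; rewrite sum_inner_primal Hx => w h.
have := sqnorm_ge0 (w - x).
by move: h; rewrite sqnormB !innerBl (innerC x w) -!sqnormE; lra.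
Qed.

(* The multipliers of the constraints defining the C_i turn the perturbed
   optimality system into the linear complementarity system of [kkt_error_bound]. *)
Lemma dual_error_bound :
  (forall i, polyhedral (C i)) ->
  exists K e0 : R, [/\ 0 <= K, 0 < e0 &
    forall y p e, 0 <= e <= e0 -> (forall i, normal_at (C i) (p i) (y i)) ->
      (forall i, entry_bound (A i *m primal y - p i) e) ->
      exists x z, kkt x z /\ forall i, entry_bound (z i - y i) (K * e)].
Proof.
move=> polyC.
have [q [B [b CE]]] : exists (q : 'I_l -> nat) (B : forall i, 'M[R]_(q i, m i))
    (b : forall i, 'cV[R]_(q i)),
    forall i, C i = [set z | forall j, (B i *m z) j 0 <= b i j 0].
  pose w1 i := cid (polyC i); pose w2 i := cid (projT2 (w1 i)).
  pose w3 i := cid (projT2 (w2 i)).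
  by exists (fun i => projT1 (w1 i)), (fun i => projT1 (w2 i)),
    (fun i => projT1 (w3 i)) => i; exact: projT2 (w3 i).
(* All scalar constraints are indexed jointly by block and row; [N] is the normal of such a
   constraint pulled back to the primal space. *)
pose T := {i : 'I_l & 'I_(q i)}.
pose tg i (j : 'I_(q i)) : T := Tagged (fun i => 'I_(q i)) j.
pose N (k : T) : 'cV[R]_n :=
  (A (tag k))^T *m ((B (tag k))^T *m delta_mx (tagged k) 0).
pose bb (k : T) : R := b (tag k) (tagged k) 0.
pose Y (c : T -> R) : dualT :=
  fun i => (B i)^T *m \col_j c (tg i j).
have NE k x : inner (N k) x = (B (tag k) *m (A (tag k) *m x)) (tagged k) 0.
  rewrite /N !inner_trmx /inner (bigD1 (tagged k)) //= big1 ?addr0 => [|j jk].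
    by rewrite !mxE !eqxx mul1r.
  by rewrite [in X in X * _]mxE (negPf jk) mul0r.
have XE c : vbar - \sum_k c k *: N k = primal (Y c).
  congr (_ - _).
  have -> : \sum_k c k *: N k = \sum_i \sum_(j < q i)
      c (tg i j) *: N (tg i j).
    by rewrite sig_big_dep; apply: eq_bigr => [[i j]] _.
  apply: eq_bigr => i _; rewrite /Y.
  rewrite (_ : \col_j _ = \sum_j c (tg i j) *: delta_mx j 0); last first.
    apply/matrixP => h h0; rewrite ord1 {h0} mxE summxE (bigD1 h) //= big1.
      by rewrite !mxE !eqxx mulr1 addr0.
    by move=> j; rewrite eq_sym => /negPf jh; rewrite !mxE jh mulr0.
  rewrite !mulmx_sumr; apply: eq_bigr => j _.
  by rewrite -!scalemxAr.
have [K [e0 [K0 e0_gt0 EB]]] := kkt_error_bound N vbar bb.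
(* [L] turns the block residual into a residual of each scalar constraint; [M] turns the distance
   between multipliers back into a distance between dual vectors. *)
pose L := 1 + \sum_i mx_sum_norm (B i).
have L0 : 0 < L by rewrite ltr_pwDl // sumr_ge0 // => i _; exact: mx_sum_norm_ge0.
pose M := \sum_i mx_sum_norm (B i)^T.
have M0 : 0 <= M by rewrite sumr_ge0 // => i _; exact: mx_sum_norm_ge0.
exists (M * (K * L)), (e0 / L); split; first by rewrite !mulr_ge0 // ltW.
  by rewrite divr_gt0.
move=> y p e /andP[e_ge0 ee] Hn Hr.
have w i : {c : 'I_(q i) -> R | [/\ forall j, 0 <= c j, y i = (B i)^T *m (\col_j c j) &
    forall j, c j != 0 -> (B i *m p i) j 0 = b i j 0]}.
  by apply: cid; have := Hn i; rewrite CE => /normal_polyhedral.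
pose c (k : T) := sval (w (tag k)) (tagged k).
have Yc : primal (Y c) = primal y.
  by rewrite /primal; congr (_ - _); apply: eq_bigr => i _;
    rewrite /Y [in RHS](let: And3 _ h _ := svalP (w i) in h).
have yE i : y i = Y c i by case: (svalP (w i)).
have dev k : `|inner (N k) (primal y) - (B (tag k) *m p (tag k)) (tagged k) 0| <= L * e.
  rewrite NE.
  have := mulmx_entry_bound (B (tag k)) e_ge0 (Hr (tag k)) (tagged k).
  rewrite mulmxBr [X in `|X|]mxE [X in _ + X]mxE => /le_trans; apply.
  rewrite ler_wpM2r // /L.
  have := ge_sum_term (fun i => mx_sum_norm (B i)) (tag k)
    (fun i => mx_sum_norm_ge0 (B i)); lra.
have [||||w' [w'c w'0 w'b w'e]] := EB c (L * e).
- by rewrite mulr_ge0 ?(ltW L0) //= mulrC -ler_pdivlMr.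
- by move=> k; rewrite /c; case: (svalP (w (tag k))).
- move=> k; rewrite XE Yc; have := dev k; rewrite ler_norml => /andP[_].
  have [+ _] := Hn (tag k); rewrite CE => /(_ (tagged k)).
  rewrite /bb; lra.
- move=> k ck; rewrite XE Yc; have := dev k; rewrite ler_norml => /andP[+ _].
  have [_ _ /(_ (tagged k) ck)] := svalP (w (tag k)).
  rewrite /bb; lra.
exists (primal (Y w')), (Y w'); split; last first.
  move=> i; rewrite yE /Y -mulmxBr.
  have : entry_bound (\col_j w' (tg i j) -
      \col_j c (tg i j)) (K * (L * e)).
    by move=> j; rewrite !mxE.
  have KLe : 0 <= K * (L * e) by rewrite !mulr_ge0 // ltW.
  move=> /(mulmx_entry_bound (B i)^T KLe) H j.
  rewrite (le_trans (H j)) // -!mulrA ler_wpM2r //.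
  by apply: (ge_sum_term (fun i => mx_sum_norm (B i)^T)) => h; exact: mx_sum_norm_ge0.
split=> // i; rewrite CE; split.
  by move=> j; have := w'b (tg i j); rewrite XE NE.
move=> z Cz; rewrite /Y !inner_trmx; apply: ler_sum => j _; rewrite mxE.
have [->|wj] := eqVneq (w' (tg i j)) 0; first by rewrite !mul0r.
rewrite ler_wpM2l //; have := w'e _ wj; rewrite XE NE /= => ->.
exact: Cz.
Qed.

End Duality.

(** * One sweep of the algorithm over the blocks *)

Section BlockStep.
Variables (R : realType) (l n : nat) (m : 'I_l -> nat).
Variables (C : forall i : 'I_l, set 'cV[R]_(m i)).
Arguments C : clear implicits.
Variables (A : forall i : 'I_l, 'M[R]_(m i, n)) (vbar : 'cV[R]_n).
Variables (gamma : 'I_l -> R) (P : forall i : 'I_l, 'cV[R]_(m i) -> 'cV[R]_(m i)).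
Arguments P : clear implicits.
Hypothesis polyC : forall i, polyhedral (C i).
Hypothesis gamma_gt0 : forall i, 0 < gamma i.
Hypothesis A_le : forall i u, sqnorm ((A i)^T *m u) <= gamma i * sqnorm u.
Hypothesis projP : forall i z, is_proj (C i) z (P i z).
Local Notation dualT := (forall i : 'I_l, 'cV[R]_(m i)).

Variables (X : nat -> 'cV[R]_n) (y y' : dualT).
Let p i := P i (gamma i *: y i + A i *m X i).
Hypothesis X0 : X 0%N = primal A vbar y.
Hypothesis XS : forall i : 'I_l,
  X i.+1 = (1%:M - (gamma i)^-1 *: ((A i)^T *m A i)) *m X i
           + (gamma i)^-1 *: ((A i)^T *m p i).
Hypothesis y'E : forall i,
  y' i = y i + (gamma i)^-1 *: (A i *m X i) - (gamma i)^-1 *: p i.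
Let D i := y' i - y i.

Lemma step_increment i : A i *m X i - p i = gamma i *: D i.
Proof.
rewrite /D y'E addrAC (addrC (y i)) addrK -scalerBr scalerA divff ?scale1r //.
exact: lt0r_neq0.
Qed.

(** The vector gamma_i y'_i is the difference between the projected point and its projection, and
    gamma_i is positive. *)
Lemma step_normal i : normal_at (C i) (p i) (y' i).
Proof.
have [Cp Hp] := proj_normal (polyC i) (projP (gamma i *: y i + A i *m X i)).
have E : gamma i *: y i + A i *m X i - p i = gamma i *: y' i.
  by rewrite -addrA step_increment -scalerDr /D addrC subrK.
split=> // c /Hp; rewrite -/(p i) E !innerZl ler_pM2l //.
Qed.

Lemma step_primal (i : 'I_l) : X i.+1 = X i - (A i)^T *m D i.
Proof.
rewrite XS mulmxBl mul1mx -scalemxAl -mulmxA -addrA; congr (_ + _).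
rewrite addrC -scalerBr -mulmxBr -[p i - _]opprB step_increment.
rewrite mulmxN scalerN -scalemxAr scalerA mulVf ?scale1r //.
exact: lt0r_neq0.
Qed.

(** The partial sum is written over all blocks with a cut-off, so that sums for different [k] can be
    subtracted termwise. *)
Lemma inner_steps k : (k <= l)%N ->
  X k = X 0%N - \sum_(i < l) (if (i < k)%N then (A i)^T *m D i else 0).
Proof.
elim: k => [|k IH] kl; first by rewrite big1 ?subr0.
rewrite (step_primal (Ordinal kl)) /= IH ?(ltnW kl) // -addrA -opprD; congr (_ - _).
rewrite (bigD1 (Ordinal kl)) //= ltnn add0r [in RHS](bigD1 (Ordinal kl)) //=.
rewrite ltnSn addrC; congr (_ + _); apply: eq_bigr => i ik.
rewrite ltnS (leq_eqVlt i); have /negPf -> // : (i : nat) != k.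
by apply: contra ik => /eqP e; apply/eqP/val_inj.
Qed.

Lemma step_primal_last : X l = primal A vbar y'.
Proof.
rewrite (inner_steps (leqnn l)) X0 /primal -addrA -opprD -big_split /=.
by congr (_ - _); apply: eq_bigr => i _; rewrite ltn_ord -mulmxDr /D addrC subrK.
Qed.

(** The projection in block i was taken at [X i], not at the final point [X l]. The two differ by
    the increments of block i and the later ones, and A_i X_i - p_i is itself gamma_i D_i. *)
Lemma step_residual e : 0 <= e -> (forall i, entry_bound (D i) e) ->
  forall i, entry_bound (A i *m primal A vbar y' - p i)
    ((\sum_i (mx_sum_norm (A i) * (\sum_j mx_sum_norm (A j)^T) + gamma i)) * e).
Proof.
move=> e0 De i.
set S := \sum_j mx_sum_norm (A j)^T.
have S0 : 0 <= S by rewrite sumr_ge0 // => j _; exact: mx_sum_norm_ge0.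
have XX : entry_bound (X l - X i) (S * e).
  rewrite (inner_steps (leqnn l)) (inner_steps (ltnW (ltn_ord i))).
  rewrite opprB (addrC (_ - _)) addrA subrK -sumrB.
  rewrite mulr_suml; apply: sum_entry_bound => j.
  have H := mulmx_entry_bound (A j)^T e0 (De j).
  rewrite ltn_ord; case: ifP => _ h.
    by rewrite subrr mxE normr0 mulr_ge0 ?mx_sum_norm_ge0.
  by rewrite add0r; apply: entry_boundN.
rewrite -step_primal_last.
have -> : A i *m X l - p i = A i *m (X l - X i) + gamma i *: D i.
  by rewrite -step_increment mulmxBr addrA subrK.
have H := entry_boundD (mulmx_entry_bound (A i) (mulr_ge0 S0 e0) XX)
  (entry_boundZ (gamma i) (De i)).
move=> j; rewrite (le_trans (H j)) // mulrA (gtr0_norm (gamma_gt0 i)) -mulrDl.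
rewrite ler_wpM2r //.
apply: (ge_sum_term (fun i => mx_sum_norm (A i) * S + gamma i)) => h.
by rewrite addr_ge0 ?mulr_ge0 ?mx_sum_norm_ge0 // ltW.
Qed.

(** The quadratic part telescopes. Block i contributes <D_i, A_i X_i> - |A_i^T D_i|^2 / 2 from it
    and at least - <D_i, p_i> from the support functions; as p_i = A_i X_i - gamma_i D_i, the total
    is gamma_i |D_i|^2 - |A_i^T D_i|^2 / 2, and [A_le] costs half of the first term. *)
Lemma step_decrease (p0 : dualT) : (forall i, normal_at (C i) (p0 i) (y i)) ->
  \sum_i gamma i / 2 * sqnorm (D i) <= dual_val A vbar y p0 - dual_val A vbar y' p.
Proof.
move=> H0.
have tele : 2^-1 * sqnorm (X 0%N) - 2^-1 * sqnorm (X l) =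
    \sum_(i < l) (2^-1 * sqnorm (X i) - 2^-1 * sqnorm (X i.+1)).
  rewrite -opprB -(@telescope_sumr _ 0 l (fun k => 2^-1 * sqnorm (X k))) // -sumrN.
  by rewrite big_mkord; apply: eq_bigr => i _; rewrite opprB.
have -> : dual_val A vbar y p0 - dual_val A vbar y' p =
    \sum_(i < l) (2^-1 * sqnorm (X i) - 2^-1 * sqnorm (X i.+1)
      + (inner (y i) (p0 i) - inner (y' i) (p i))).
  rewrite big_split /= -tele sumrB X0 step_primal_last /dual_val; ring.
apply: ler_sum => i _.
have h1 : inner (y i) (p i) <= inner (y i) (p0 i).
  by apply: (H0 i).2; case: (step_normal i).
have h2 := A_le (D i).
rewrite step_primal (sqnormB (X i)) (innerC (X i)) inner_trmx.
have pE : p i = A i *m X i - gamma i *: D i by rewrite -step_increment subKr.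
have h3 : inner (y' i) (p i) - inner (y i) (p i) =
    inner (D i) (A i *m X i) - gamma i * sqnorm (D i).
  by rewrite -innerBl -/(D i) {1}pE innerBr innerZr sqnormE.
lra.
Qed.

End BlockStep.

(** * Linear convergence of the iterates *)

Unset Implicit Arguments.

Theorem theorem5p1 (R : realType) (l n : nat) (m : 'I_l -> nat)
  (C : forall i : 'I_l, set 'cV[R]_(m i))
  (A : forall i : 'I_l, 'M[R]_(m i, n))
  (vbar : 'cV[R]_n)
  (xstar : 'cV[R]_n)
  (gamma : 'I_l -> R)
  (P : forall i : 'I_l, 'cV[R]_(m i) -> 'cV[R]_(m i))
  (xs : nat -> nat -> 'cV[R]_n)
  (ys : nat -> forall i : 'I_l, 'cV[R]_(m i)) :
  (0 < l)%N -> (0 < n)%N -> (forall i, (0 < m i)%N) ->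
  (forall i, polyhedral (C i)) ->
  (forall i, C i !=set0) ->
  (forall i, A i != 0) ->
  (exists x : 'cV[R]_n, forall i, C i (A i *m x)) ->
  (* x* solves min 1/2 ||x - vbar||^2 s.t. A_i x in C_i *)
  (forall i, C i (A i *m xstar)) ->
  (forall x : 'cV[R]_n, (forall i, C i (A i *m x)) ->
     2^-1 * sqnorm (xstar - vbar) <= 2^-1 * sqnorm (x - vbar)) ->
  (* gamma_i = lambda_max (A_i^T A_i) *)
  (forall i, is_lambda_max ((A i)^T *m A i) (gamma i)) ->
  (* P i = Proj_{C_i} *)
  (forall i z, is_proj (C i) z (P i z)) ->
  (* the algorithm; xs t i = x^t_i, ys t i = y^t_{i+1} (0-based blocks) *)
  (forall i, ys 0%N i = 0) ->
  xs 0%N l = vbar ->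
  (forall t, xs t.+1 0%N = xs t l) ->
  (forall t (i : 'I_l),
     xs t.+1 i.+1 =
       (1%:M - (gamma i)^-1 *: ((A i)^T *m A i)) *m xs t.+1 i
       + (gamma i)^-1 *: ((A i)^T *m P i (gamma i *: ys t i + A i *m xs t.+1 i))) ->
  (forall t (i : 'I_l),
     ys t.+1 i =
       ys t i + (gamma i)^-1 *: (A i *m xs t.+1 i)
       - (gamma i)^-1 *: P i (gamma i *: ys t i + A i *m xs t.+1 i)) ->
  let d := dual_fun C A vbar in
  let dstar := ereal_inf [set d y | y in [set: forall i : 'I_l, 'cV[R]_(m i)]] in
  (exists y0, forall y, (d y0 <= d y)%E) /\
  exists ystar : forall i : 'I_l, 'cV[R]_(m i),
    (forall y, (d ystar <= d y)%E) /\
    exists (r a0 a1 : R) (tbar : nat),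
      [/\ 0 < r < 1, 0 < a0 < 1, 0 < a1, (0 < tbar)%N &
        forall t : nat, (tbar <= t)%N ->
          [/\ enorm (xs t l - xstar) <= a1 * a0 ^+ t,
              (d (ys t.+1) - dstar <= r%:E * (d (ys t) - dstar))%E &
              prod_dist (ys t) ystar <= a1 * a0 ^+ t]].
Proof.
move=> _ _ _ polyC C0 A0 _ xsC xsmin lmax projP ys0 xs0 xsS0 xsS ysS d dstar.
have gam i := trmx_sqnorm_le (A0 i) (lmax i).
have gam0 i : 0 < gamma i by case: (gam i).
have Ale i u : sqnorm ((A i)^T *m u) <= gamma i * sqnorm u by case: (gam i).
(* Points attaining the support functions at [ys t]: the projections of the previous sweep, or any
   point of C_i at the start, where y = 0. *)
pose q t : forall i : 'I_l, 'cV[R]_(m i) := match t with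
  | 0%N => fun i => sval (cid (C0 i))
  | t.+1 => fun i => P i (gamma i *: ys t i + A i *m xs t.+1 i)
  end.
have xsE t : xs t l = primal A vbar (ys t).
  elim: t => [|t IH].
    by rewrite xs0 /primal big1 ?subr0 // => i _; rewrite ys0 mulmx0.
  apply: (@step_primal_last _ _ _ _ A vbar gamma P gam0 (xs t.+1) (ys t)) => //.
  by rewrite xsS0.
have X0 t : xs t.+1 0%N = primal A vbar (ys t) by rewrite xsS0.
have qn t i : normal_at (C i) (q t i) (ys t i).
  case: t => [|t]; last first.
    exact: (step_normal polyC gam0 projP (ysS t) i).
  rewrite ys0; split; first exact: svalP (cid (C0 i)).
  by move=> c _; rewrite !inner0l.
(* The dual gap as a real number; that [opt_val vbar xstar] equals [dstar] is known only once a dual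
   minimiser is found. *)
pose E t := dual_val A vbar (ys t) (q t) - opt_val vbar xstar.
have dE t : d (ys t) = (E t + opt_val vbar xstar)%:E.
  by rewrite /d (dual_fun_normal _ _ (qn t)) subrK.
have E0 t : 0 <= E t.
  have := dual_fun_ge vbar (ys t) xsC.
  by rewrite (dual_fun_normal _ _ (qn t)) lee_fin subr_ge0.
pose D t i := ys t.+1 i - ys t i.
pose S t := \sum_i sqnorm (D t i).
have S_ge0 t : 0 <= S t by apply: sumr_ge0 => i _; exact: sqnorm_ge0.
pose g := \big[Num.min/1]_i gamma i.
have g0 : 0 < g by apply/bigmin_gtP; split.
have dec t : g / 2 * S t <= E t - E t.+1.
  rewrite /E opprB addrA subrK.
  apply: le_trans (step_decrease polyC gam0 Ale projP (X0 t) (xsS t) (ysS t) (qn t)).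
  rewrite /S mulr_sumr; apply: ler_sum => i _.
  by rewrite ler_wpM2r ?sqnorm_ge0 // ler_pM2r ?invr_gt0 // bigmin_le.
have Edec t : E t.+1 <= E t.
  by rewrite -subr_ge0 (le_trans _ (dec t)) // mulr_ge0 // divr_ge0 // ltW.
pose e t := Num.sqrt (S t).
have e_ge0 t : 0 <= e t by exact: sqrtr_ge0.
have eE t : e t ^+ 2 = S t by rewrite sqr_sqrtr.
have De t i : entry_bound (D t i) (e t).
  move=> j; rewrite -sqrtr_sqr ler_wsqrtr // (le_trans (sqnorm_ge_entry _ j)) //.
  by apply: (ge_sum_term (fun i => sqnorm (D t i))) => h; exact: sqnorm_ge0.
set Kr := \sum_i (mx_sum_norm (A i) * (\sum_j mx_sum_norm (A j)^T) + gamma i).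
have Kr0 : 0 <= Kr.
  apply: sumr_ge0 => i _; rewrite addr_ge0 ?(ltW (gam0 i)) // mulr_ge0 ?mx_sum_norm_ge0 //.
  by apply: sumr_ge0 => j _; exact: mx_sum_norm_ge0.
have res t i : entry_bound (A i *m primal A vbar (ys t.+1) - q t.+1 i) (Kr * e t).
  exact: (step_residual gam0 (X0 t) (xsS t) (ysS t) (e_ge0 t) (De t)).
have [K [e0 [K0 e0_gt0 EB]]] := dual_error_bound A vbar polyC.
have [t0 small] : exists t0, forall t, (t0 <= t)%N -> Kr * e t <= e0.
  (* A decrement of at most [eta] forces [e t <= e0 / (1 + Kr)], which brings the residual below the
     threshold [e0]. *)
  pose eta := g / 2 * (e0 / (1 + Kr)) ^+ 2.
  have Kr1 : 0 < 1 + Kr by rewrite ltr_pwDl.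
  have q0 : 0 <= e0 / (1 + Kr) by rewrite divr_ge0 // ltW.
  have eta0 : 0 < eta by rewrite mulr_gt0 ?exprn_gt0 ?divr_gt0.
  have [t0 H] := decrement_small E0 Edec eta0.
  exists t0 => t /H /(le_trans (dec t)).
  rewrite ler_pM2l ?divr_gt0 // -eE ler_pXn2r ?nnegrE //.
  rewrite ler_pdivlMr // => h; rewrite (le_trans _ h) // mulrC ler_wpM2l //; lra.
(* The dual part of the exact solution depends on [t], but its primal part is always [xstar] by
   [kkt_unique]. *)
have near t : (t0 <= t)%N -> exists z, kkt C A vbar xstar z /\
    forall i, entry_bound (z i - ys t.+1 i) (K * (Kr * e t)).
  move=> t0t; have [|x [z [xz zy]]] := EB _ _ (Kr * e t) _ (qn t.+1) (res t).
    by rewrite mulr_ge0 //= small.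
  by exists z; rewrite -(kkt_unique xz xsC xsmin).
pose c := (\sum_i (m i)%:R) * (K * Kr * Kr).
have c0 : 0 <= c by rewrite !mulr_ge0 // sumr_ge0.
have gap t : (t0 <= t)%N -> E t.+1 <= c * S t.
  move=> /near[z [zk zy]]; rewrite (le_trans (dual_gap_le (qn t.+1) zk)) //.
  rewrite /c !mulr_suml; apply: ler_sum => i _.
  have KKe : 0 <= K * (Kr * e t) by rewrite !mulr_ge0.
  have := inner_entry_bound KKe (zy i) (res t i).
  by move=> /(le_trans (ler_norm _)); rewrite -eE; lra.
(* [gap] and [dec] give E_{t+1} <= c1 (E_t - E_{t+1}), which is contraction by [c1 / (1 + c1)]; the
   added 1 keeps this rate positive. *)
pose c1 := 1 + c / (g / 2).
have c10 : 0 < c1 by rewrite ltr_pwDl // divr_ge0 // divr_ge0 // ltW.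
pose r := c1 / (1 + c1).
have r0 : 0 < r by rewrite divr_gt0 // addr_gt0.
have c11 : 0 < 1 + c1 by exact: addr_gt0.
have r1 : r < 1 by rewrite ltr_pdivrMr // mul1r ltrDr.
have Er t : (t0 <= t)%N -> E t.+1 <= r * E t.
  move=> t0t; have h1 : E t.+1 <= c1 * (E t - E t.+1).
    have h : S t <= (E t - E t.+1) / (g / 2) by rewrite ler_pdivlMr ?divr_gt0 // mulrC.
    have : c * S t <= c * ((E t - E t.+1) / (g / 2)) by rewrite ler_wpM2l.
    have c1E x : c1 * x = x + c * (x / (g / 2)).
      by rewrite /c1 mulrDl mul1r mulrAC mulrA.
    by have := gap t t0t; have := Edec t; rewrite c1E; lra.
  rewrite /r mulrAC ler_pdivlMr //; lra.
pose c2 := E t0 / r ^+ t0.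
have Egeo t : (t0 <= t)%N -> E t <= c2 * r ^+ t.
  move=> t0t; rewrite -(subnKC t0t); elim: (t - t0)%N => [|k IH].
    by rewrite addn0 /c2 divfK // expf_neq0 // gt_eqF.
  rewrite addnS (le_trans (Er _ (leq_addr k t0))) // exprS mulrCA.
  by rewrite ler_pM2l.
(* Steps are controlled by square roots of dual gaps, so they decay at the rate sqrt r. *)
pose rho := Num.sqrt r.
have rho0 : 0 < rho by rewrite sqrtr_gt0.
have rhoE : rho ^+ 2 = r by rewrite sqr_sqrtr // ltW.
have rho1 : rho < 1 by rewrite -sqrtr1 ltr_sqrt.
have rho01 : 0 < rho < 1 by rewrite rho0.
have c20 : 0 <= c2 by rewrite divr_ge0 // exprn_ge0 // ltW.
pose c4 := Num.sqrt (c2 / (g / 2)).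
have c40 : 0 <= c4 by exact: sqrtr_ge0.
have egeo t : (t0 <= t)%N -> e t <= c4 * rho ^+ t.
  move=> t0t; have rt : 0 <= rho ^+ t by rewrite exprn_ge0 // ltW.
  have -> : c4 * rho ^+ t = Num.sqrt (c2 / (g / 2) * r ^+ t).
    by rewrite sqrtrM ?(divr_ge0 c20 (ltW (divr_gt0 g0 _))) // -rhoE exprAC sqrtr_sqr ger0_norm.
  apply: ler_wsqrtr; rewrite mulrAC ler_pdivlMr ?divr_gt0 // mulrC.
  have := dec t; have := Egeo t t0t; have := E0 t.+1; lra.
have lim i (j : 'I_(m i)) : exists L, forall t, (t0 <= t)%N ->
    `|ys t i j 0 - L| <= c4 / (1 - rho) * rho ^+ t.
  apply: (@geometric_cauchy R (fun t => ys t i j 0)) => // t t0t.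
  by rewrite (le_trans _ (egeo t t0t)) //; have := De t i j; rewrite !mxE.
pose ystar : forall i, 'cV[R]_(m i) := fun i => \col_j sval (cid (lim i j)).
pose c5 := c4 / (1 - rho).
have c50 : 0 <= c5 by rewrite divr_ge0 // subr_ge0 ltW.
have ylim t i : (t0 <= t)%N -> entry_bound (ys t i - ystar i) (c5 * rho ^+ t).
  by move=> t0t j; rewrite !mxE; exact: svalP (cid (lim i j)) t t0t.
pose c6 := c5 * rho + K * (Kr * c4).
have c60 : 0 <= c6 by rewrite addr_ge0 ?(mulr_ge0 c50 (ltW rho0)) // !mulr_ge0.
(* Both the limit [ystar] and the exact solution [z] are close to [ys t.+1]; the index shift
   produces the factor [rho] in [c6]. *)
have near' t : (t0 <= t)%N -> exists z, kkt C A vbar xstar z /\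
    forall i, entry_bound (ystar i - z i) (c6 * rho ^+ t).
  move=> t0t; have [z [zk zy]] := near t t0t; exists z; split => // i.
  have -> : ystar i - z i = - ((ys t.+1 i - ystar i) + (z i - ys t.+1 i)).
    by rewrite (addrC (ys _ _ - _)) addrA subrK opprB.
  apply: entry_boundN => j.
  rewrite (le_trans (entry_boundD (ylim t.+1 i (leqW t0t)) (zy i) j)) //.
  rewrite /c6 mulrDl lerD //; first by rewrite -mulrA -exprS.
  by rewrite -!mulrA ler_wpM2l // ler_wpM2l // egeo.
have rt0 t : 0 <= rho ^+ t by rewrite exprn_ge0 // ltW.
(* The optimality system at the fixed point [xstar] is closed in the dual variable, so it passes
   from the solutions [z] to their limit. *)
have ystar_kkt : kkt C A vbar xstar ystar.
  split.
    move=> i; split => // v Cv; rewrite -subr_le0 -innerBr.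
    set w := v - A i *m xstar.
    apply: (@le0_of_le_geometric R _ ((m i)%:R * (c6 * enorm w)) rho t0) => // t t0t.
    have [z [[zn _] zy]] := near' t t0t.
    have -> : inner (ystar i) w = inner (ystar i - z i) w + inner (z i) w.
      by rewrite innerBl subrK.
    have h1 : inner (z i) w <= 0 by rewrite innerBr subr_le0; exact: (zn i).2.
    have := inner_entry_bound (mulr_ge0 c60 (rt0 t)) (zy i) (entry_bound_sqrt w).
    move=> /(le_trans (ler_norm _)); rewrite -!mulrA (mulrC (rho ^+ t)); lra.
  apply/eqP; rewrite -subr_eq0; apply/eqP/matrixP => j j0; rewrite ord1 {j0} [RHS]mxE.
  apply/eqP; rewrite -normr_le0.
  apply: (@le0_of_le_geometric R _ (\sum_i mx_sum_norm (A i)^T * c6) rho t0) => // t t0t.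
  have [z [[_ zx] zy]] := near' t t0t.
  have -> : primal A vbar ystar - xstar = - \sum_i (A i)^T *m (ystar i - z i).
    by rewrite -zx primal_sub.
  rewrite mulr_suml; apply: entry_boundN; apply: sum_entry_bound => i.
  rewrite -mulrA; apply: mulmx_entry_bound => //; exact: mulr_ge0.
have ystar_min z : (d ystar <= d z)%E by exact: kkt_argmin ystar_kkt.
have dstarE : dstar = (opt_val vbar xstar)%:E.
  rewrite -(kkt_dual_fun ystar_kkt); apply/eqP; rewrite eq_le; apply/andP; split.
    by apply: ereal_inf_lbound; exists ystar.
  by apply: le_ereal_inf_tmp => _ [z _ <-]; exact: ystar_min.
split; first by exists ystar.
exists ystar; split => //.
pose M := \sum_i (m i)%:R : R.
have M0 : 0 <= M by exact: sumr_ge0.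
pose c7 := (\sum_i mx_sum_norm (A i)^T) * c5.
have c70 : 0 <= c7.
  by rewrite mulr_ge0 // sumr_ge0 // => i _; exact: mx_sum_norm_ge0.
have s1 : 0 <= Num.sqrt n%:R * c7 by rewrite mulr_ge0 ?sqrtr_ge0.
have s2 : 0 <= Num.sqrt M * c5 by rewrite mulr_ge0 ?sqrtr_ge0.
have sqrtE (N a : R) : 0 <= N -> 0 <= a -> Num.sqrt (N * a ^+ 2) = Num.sqrt N * a.
  by move=> N0 a0; rewrite sqrtrM // sqrtr_sqr ger0_norm.
(* The 1 makes [a1] positive, and the successor makes the starting index positive. *)
exists r, rho, (1 + Num.sqrt n%:R * c7 + Num.sqrt M * c5), t0.+1; split => //.
- by rewrite r0.
- by lra.
move=> t t0t; have {}t0t := ltnW t0t; split.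
- apply: (@le_trans _ _ (Num.sqrt n%:R * c7 * rho ^+ t)); last first.
    by rewrite ler_wpM2r //; lra.
  rewrite /enorm -mulrA -(sqrtE _ _ (ler0n R n) (mulr_ge0 c70 (rt0 t))); apply: ler_wsqrtr.
  apply: entry_bound_sqnorm; first exact: mulr_ge0.
  have <- : primal A vbar ystar = xstar by case: ystar_kkt.
  have -> : xs t l - primal A vbar ystar = - \sum_i (A i)^T *m (ys t i - ystar i).
    by rewrite xsE primal_sub.
  rewrite /c7 -mulrA mulr_suml; apply: entry_boundN; apply: sum_entry_bound => i.
  by apply: mulmx_entry_bound; [exact: mulr_ge0|exact: ylim].
- by rewrite dstarE !dE -!EFinB -EFinM lee_fin !addrK; exact: Er.
- apply: (@le_trans _ _ (Num.sqrt M * c5 * rho ^+ t)); last first.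
    by rewrite ler_wpM2r //; lra.
  rewrite /prod_dist -mulrA -(sqrtE _ _ M0 (mulr_ge0 c50 (rt0 t))); apply: ler_wsqrtr.
  rewrite mulr_suml; apply: ler_sum => i _.
  by apply: entry_bound_sqnorm; [exact: mulr_ge0|exact: ylim].
Qed.
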